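(* Let $p$ be a prime. For all $n\in\mathbb N$, $$n\cdot\|n\|_p=\min\left\{\theta_p(0^k)(n)\right\}_{k\in\mathbb N},$$ where the minimum is over those $k$ for which $\theta_p(0^k)(n)$ is defined.
   Context: $\mathbb N=\{0,1,2,\dots\}$. $\|\cdot\|_p$ is the $p$-adic norm: $\|0\|_p=0$ and $\|n\|_p=p^{-ord_p(n)}$ for $n\ge1$, with $ord_p(n)=\max\{k\in\mathbb N:p^k\mid n\}$. $\mathcal P_p$ (the $p$-th polycyclic monoid) is the inverse monoid with zero $\epsilon$ generated by $\{0,\dots,p-1\}$ subject to $xy^\ddagger=Id$ if $x=y$ and $xy^\ddagger=\epsilon$ if $x\neq y$. $\theta_p$ is the injective inverse monoid homomorphism from $\mathcal P_p$ to the monoid of partial injections on $\mathbb N$ (under composition of partial functions) with $\theta_p(x)=R_{p,x}$ for $0\le x<p$, where for $a>b\in\mathbb N$ the partial injection $R_{a,b}$ has domain $\{am+b:m\in\mathbb N\}$ and $R_{a,b}(n)=\frac{n-b}{a}$. The word $0^k=00\cdots0$ denotes the string of $k$ copies of the generator $0$ (the identity when $k=0$). *)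

(* Defs.v *)
From HB Require Import structures.
From mathcomp Require Import all_boot all_order all_algebra.
From mathcomp Require Import generic_quotient boolp classical_sets.
Set Implicit Arguments.
Unset Strict Implicit.
Unset Printing Implicit Defensive.

Local Open Scope group_scope.
Local Open Scope quotient_scope.

(* An involutive monoid is inverse iff the involution provides generalized
   inverses and the idempotents [x * x^-1] commute. *)
HB.mixin Record StarMonoid_isInverseMonoid M of StarMonoid M := {
  mulgVg : forall x : M, x * x^-1 * x = x;
  mulgVC : forall x y : M, x * x^-1 * (y * y^-1) = y * y^-1 * (x * x^-1) }.

#[short(type="inverseMonoidType")]
HB.structure Definition InverseMonoid :=
  { M of StarMonoid_isInverseMonoid M & StarMonoid M }.

HB.mixin Record InverseMonoid_hasZero M of InverseMonoid M := {
  zerog : M;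
  mul0g : forall x : M, zerog * x = zerog;
  mulg0 : forall x : M, x * zerog = zerog }.

#[short(type="inverseMonoid0Type")]
HB.structure Definition InverseMonoid0 :=
  { M of InverseMonoid_hasZero M & InverseMonoid M }.

Definition inverse_monoid0_hom (M N : inverseMonoid0Type) (f : M -> N) : Prop :=
  [/\ monoid_morphism f, {morph f : x / x^-1} & f zerog = zerog].

(* Partial injections on nat: [None] means undefined. *)
Record partinj := Partinj {
  partinj_fun :> nat -> option nat;
  partinjP : forall m n k,
    partinj_fun m = Some k -> partinj_fun n = Some k -> m = n }.

HB.instance Definition _ := gen_eqMixin partinj.
HB.instance Definition _ := gen_choiceMixin partinj.

Lemma eq_partinj (f g : partinj) :
  (forall m n, f m = Some n <-> g m = Some n) -> f = g.
Proof.
case: f g => [f fP] [g gP] /= fg.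
have E : f = g.
  apply/funext => m; case Ef : (f m) => [n|]; first by symmetry; apply/fg.
  by case Eg : (g m) => [n|] //; move/fg: Eg; rewrite Ef.
by subst g; congr Partinj; apply: Prop_irrelevance.
Qed.

Lemma partinj_id_subproof (m n k : nat) : Some m = Some k -> Some n = Some k -> m = n.
Proof. by move=> -[->] [->]. Qed.
Definition partinj_id := Partinj partinj_id_subproof.

Lemma partinj_empty_subproof (m n k : nat) :
  None = Some k -> None = Some k -> m = n.
Proof. by []. Qed.
Definition partinj_empty := Partinj partinj_empty_subproof.

Lemma obind_Some (f g : nat -> option nat) m n :
  obind f (g m) = Some n <-> exists2 k, g m = Some k & f k = Some n.
Proof.
case: (g m) => [k|] /=; split => //; first by exists k.
- by move=> [k' [->]].
- by move=> [].
Qed.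

Lemma partinj_comp_subproof (f g : partinj) m n k :
  obind f (g m) = Some k -> obind f (g n) = Some k -> m = n.
Proof.
move=> /obind_Some [a ga fa] /obind_Some [b gb fb].
by apply: partinjP ga _; rewrite gb (partinjP fb fa).
Qed.
Definition partinj_comp f g := Partinj (@partinj_comp_subproof f g).

Definition partinj_inv_fun (f : partinj) n : option nat :=
  xget None [set o | exists2 m, o = Some m & f m = Some n].

Lemma partinj_inv_funP (f : partinj) n m :
  partinj_inv_fun f n = Some m <-> f m = Some n.
Proof.
rewrite /partinj_inv_fun; case: xgetP => [o _ [k -> fk]|H].
  by split=> [[<-]//|fm]; rewrite (partinjP fk fm).
by split=> // fm; case: (H (Some m)); exists m.
Qed.

Lemma partinj_inv_subproof (f : partinj) m n k :
  partinj_inv_fun f m = Some k -> partinj_inv_fun f n = Some k -> m = n.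
Proof. by move=> /partinj_inv_funP fm /partinj_inv_funP; rewrite fm => -[]. Qed.
Definition partinj_inv f := Partinj (@partinj_inv_subproof f).

Lemma partinj_compP (f g : partinj) m n :
  partinj_comp f g m = Some n <-> exists2 k, g m = Some k & f k = Some n.
Proof. exact: obind_Some. Qed.

Lemma partinj_invP (f : partinj) n m : partinj_inv f n = Some m <-> f m = Some n.
Proof. exact: partinj_inv_funP. Qed.

Lemma partinj_compA : associative partinj_comp.
Proof.
move=> f g h; apply: eq_partinj => m n; rewrite !partinj_compP; split.
  move=> [k /partinj_compP[j hj gk] fn]; exists j => //.
  by apply/partinj_compP; exists k.
move=> [j hj /partinj_compP[k gk fn]]; exists k => //.
by apply/partinj_compP; exists j.
Qed.

Lemma partinj_comp1f : left_id partinj_id partinj_comp.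
Proof.
move=> f; apply: eq_partinj => m n.
by split=> [/partinj_compP[k fk [<-]]//|fm]; apply/partinj_compP; exists n.
Qed.

Lemma partinj_compf1 : right_id partinj_id partinj_comp.
Proof.
move=> f; apply: eq_partinj => m n.
by split=> [/partinj_compP[k [<-]]//|fm]; apply/partinj_compP; exists m.
Qed.

Lemma partinj_invK : involutive partinj_inv.
Proof. by move=> f; apply: eq_partinj => m n; rewrite !partinj_invP. Qed.

Lemma partinj_invM :
  {morph partinj_inv : f g / partinj_comp f g >-> partinj_comp g f}.
Proof.
move=> f g; apply: eq_partinj => m n; rewrite partinj_invP !partinj_compP.
by split=> -[k fk gk]; exists k; apply/partinj_invP.
Qed.

(* The product is composition in applicative order: [(f * g) n = f (g n)]. *)
HB.instance Definition _ := isStarMonoid.Build partinj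
  partinj_compA partinj_comp1f partinj_invK partinj_invM.

Lemma partinj_idemP (f : partinj) m n :
  (f * f^-1) m = Some n <-> m = n /\ exists k, f k = Some m.
Proof.
rewrite partinj_compP; split=> [[k /partinj_invP fk]|[<- [k fk]]].
  by rewrite fk => -[<-]; split=> //; exists k.
by exists k => //; apply/partinj_invP.
Qed.

Lemma partinj_mulgVg (f : partinj) : f * f^-1 * f = f.
Proof.
apply: eq_partinj => m n.
split=> [/partinj_compP[k fm /partinj_idemP[<-]]//|fm].
by apply/partinj_compP; exists n => //; apply/partinj_idemP; split=> //; exists m.
Qed.

Lemma partinj_mulgVC (f g : partinj) :
  f * f^-1 * (g * g^-1) = g * g^-1 * (f * f^-1).
Proof.
apply: eq_partinj => m n; rewrite !partinj_compP.
by split=> -[k /partinj_idemP[<- H1] /partinj_idemP[<- H2]];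
  exists m; apply/partinj_idemP.
Qed.

HB.instance Definition _ := StarMonoid_isInverseMonoid.Build partinj
  partinj_mulgVg partinj_mulgVC.

Lemma partinj_comp0f : left_zero partinj_empty partinj_comp.
Proof. by move=> f; apply: eq_partinj => m n; split=> // /partinj_compP[]. Qed.

Lemma partinj_compf0 : right_zero partinj_empty partinj_comp.
Proof. by move=> f; apply: eq_partinj => m n; split=> // /partinj_compP[]. Qed.

HB.instance Definition _ := InverseMonoid_hasZero.Build partinj
  partinj_comp0f partinj_compf0.

Definition Rab_fun a b n : option nat :=
  if (b <= n) && (a %| n - b) then Some ((n - b) %/ a) else None.

Lemma Rab_funP a b n m : b < a -> Rab_fun a b n = Some m <-> n = (a * m + b)%N.
Proof.
move=> ba; have a0 : 0 < a by apply: leq_trans ba.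
rewrite /Rab_fun; split; last first.
  by move=> ->; rewrite leq_addl addnK dvdn_mulr // mulKn.
by case: ifP => // /andP[bn dv] [<-]; rewrite mulnC divnK // subnK.
Qed.

Lemma Rab_subproof a b (ba : b < a) m n k :
  Rab_fun a b m = Some k -> Rab_fun a b n = Some k -> m = n.
Proof. by move=> /(Rab_funP _ _ ba) -> /(Rab_funP _ _ ba). Qed.
Definition Rab a b (ba : b < a) : partinj := Partinj (Rab_subproof ba).

Lemma Rab_inv_mul a b c (ba : b < a) (ca : c < a) :
  Rab ba * (Rab ca)^-1 = if b == c then 1 else zerog.
Proof.
have a0 : 0 < a by apply: leq_trans ba.
apply: eq_partinj => m n; rewrite partinj_compP.
have -> : (exists2 k, partinj_inv (Rab ca) m = Some k & Rab ba k = Some n) <->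
          (b = c /\ m = n).
  split=> [[k /partinj_invP/(Rab_funP _ _ ca) -> /(Rab_funP _ _ ba) E]|[bc mn]].
    have cb : c = b.
      by move/(congr1 (modn^~ a)): E; rewrite ![(a * _)%N]mulnC !modnMDl !modn_small.
    by subst c; move/addIn: E => /eqP; rewrite eqn_pmul2l // => /eqP.
  exists (a * m + c)%N; first exact/partinj_invP/Rab_funP.
  by apply/Rab_funP => //; rewrite bc mn.
by case: eqP => bc; split=> [[]|] => //; [move=> _ -> | case].
Qed.

(* [pterm p] are the terms over the signature of inverse monoids with zero, and
   [peqv] is the congruence generated by the identities of inverse monoids with
   zero together with the defining relations of the polycyclic monoid. *)
Inductive pterm (p : nat) :=
  | PGen of 'I_p
  | POne
  | PZero
  | PMul of pterm p & pterm p
  | PInv of pterm p.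
Arguments POne {p}.
Arguments PZero {p}.

Inductive peqv (p : nat) : pterm p -> pterm p -> Prop :=
  | peqv_refl s : peqv s s
  | peqv_sym s t : peqv s t -> peqv t s
  | peqv_trans s t u : peqv s t -> peqv t u -> peqv s u
  | peqv_mul s s' t t' : peqv s s' -> peqv t t' -> peqv (PMul s t) (PMul s' t')
  | peqv_inv s s' : peqv s s' -> peqv (PInv s) (PInv s')
  | peqv_mulA s t u : peqv (PMul s (PMul t u)) (PMul (PMul s t) u)
  | peqv_mul1 s : peqv (PMul POne s) s
  | peqv_1mul s : peqv (PMul s POne) s
  | peqv_mul0 s : peqv (PMul PZero s) PZero
  | peqv_0mul s : peqv (PMul s PZero) PZero
  | peqv_invK s : peqv (PInv (PInv s)) s
  | peqv_invM s t : peqv (PInv (PMul s t)) (PMul (PInv t) (PInv s))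
  | peqv_mulV s : peqv (PMul (PMul s (PInv s)) s) s
  | peqv_mulVC s t : peqv (PMul (PMul s (PInv s)) (PMul t (PInv t)))
                          (PMul (PMul t (PInv t)) (PMul s (PInv s)))
  | peqv_gen_id x : peqv (PMul (PGen x) (PInv (PGen x))) POne
  | peqv_gen_zero x y : x <> y -> peqv (PMul (PGen x) (PInv (PGen y))) PZero.

Section Polycyclic.
Variable p : nat.

HB.instance Definition _ := gen_eqMixin (pterm p).
HB.instance Definition _ := gen_choiceMixin (pterm p).

Definition peqvb (s t : pterm p) : bool := `[< peqv s t >].

Lemma peqvb_refl : reflexive peqvb.
Proof. by move=> s; apply/asboolP; exact: peqv_refl. Qed.
Lemma peqvb_sym : symmetric peqvb.
Proof. by move=> s t; apply/asboolP/asboolP; exact: peqv_sym. Qed.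
Lemma peqvb_trans : transitive peqvb.
Proof.
by move=> t s u /asboolP st /asboolP tu; apply/asboolP; exact: peqv_trans tu.
Qed.

Canonical peqvb_equiv := EquivRel peqvb peqvb_refl peqvb_sym peqvb_trans.

Definition polycyclic := {eq_quot peqvb}.
HB.instance Definition _ := Choice.on polycyclic.

Local Notation pi := (\pi_polycyclic).

Lemma polycyclic_piP s t : pi s = pi t <-> peqv s t.
Proof. by split=> [/eqmodP/asboolP|st]; [|apply/eqmodP/asboolP]. Qed.

Lemma polycyclic_repr s : peqv (repr (pi s)) s.
Proof. by apply/polycyclic_piP; rewrite reprK. Qed.

Definition polycyclic_mul (x y : polycyclic) := pi (PMul (repr x) (repr y)).
Definition polycyclic_inv (x : polycyclic) := pi (PInv (repr x)).
Definition polycyclic_zero : polycyclic := pi PZero.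
Definition pgen (x : 'I_p) : polycyclic := pi (PGen x).

Lemma polycyclic_mulE s t : polycyclic_mul (pi s) (pi t) = pi (PMul s t).
Proof. by apply/polycyclic_piP; apply: peqv_mul; apply: polycyclic_repr. Qed.

Lemma polycyclic_invE s : polycyclic_inv (pi s) = pi (PInv s).
Proof. by apply/polycyclic_piP; apply: peqv_inv; apply: polycyclic_repr. Qed.

Lemma polycyclic_ind (P : polycyclic -> Prop) :
  (forall s, P (pi s)) -> forall x, P x.
Proof. by move=> H x; rewrite -[x]reprK. Qed.

Lemma polycyclic_mulA : associative polycyclic_mul.
Proof.
elim/polycyclic_ind=> s; elim/polycyclic_ind=> t; elim/polycyclic_ind=> u.
by rewrite !polycyclic_mulE; apply/polycyclic_piP; exact: peqv_mulA.
Qed.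

Lemma polycyclic_mul1 : left_id (pi POne) polycyclic_mul.
Proof.
elim/polycyclic_ind=> s.
by rewrite polycyclic_mulE; apply/polycyclic_piP; exact: peqv_mul1.
Qed.

Lemma polycyclic_1mul : right_id (pi POne) polycyclic_mul.
Proof.
elim/polycyclic_ind=> s.
by rewrite polycyclic_mulE; apply/polycyclic_piP; exact: peqv_1mul.
Qed.

Lemma polycyclic_invK : involutive polycyclic_inv.
Proof.
elim/polycyclic_ind=> s.
by rewrite !polycyclic_invE; apply/polycyclic_piP; exact: peqv_invK.
Qed.

Lemma polycyclic_invM :
  {morph polycyclic_inv : x y / polycyclic_mul x y >-> polycyclic_mul y x}.
Proof.
elim/polycyclic_ind=> s; elim/polycyclic_ind=> t.
rewrite polycyclic_mulE !polycyclic_invE polycyclic_mulE.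
by apply/polycyclic_piP; exact: peqv_invM.
Qed.

HB.instance Definition _ := isStarMonoid.Build polycyclic
  polycyclic_mulA polycyclic_mul1 polycyclic_invK polycyclic_invM.

Lemma polycyclic_mulgVg (x : polycyclic) : x * x^-1 * x = x.
Proof.
elim/polycyclic_ind: x => s.
rewrite -[_^-1]/(polycyclic_inv _) -![_ * _]/(polycyclic_mul _ _).
rewrite polycyclic_invE !polycyclic_mulE.
by apply/polycyclic_piP; exact: peqv_mulV.
Qed.

Lemma polycyclic_mulgVC (x y : polycyclic) :
  x * x^-1 * (y * y^-1) = y * y^-1 * (x * x^-1).
Proof.
elim/polycyclic_ind: x => s; elim/polycyclic_ind: y => t.
rewrite -![_^-1]/(polycyclic_inv _) -![_ * _]/(polycyclic_mul _ _).
rewrite !polycyclic_invE !polycyclic_mulE.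
by apply/polycyclic_piP; exact: peqv_mulVC.
Qed.

HB.instance Definition _ := StarMonoid_isInverseMonoid.Build polycyclic
  polycyclic_mulgVg polycyclic_mulgVC.

Lemma polycyclic_0mul (x : polycyclic) : polycyclic_zero * x = polycyclic_zero.
Proof.
elim/polycyclic_ind: x => s; rewrite -[_ * _]/(polycyclic_mul _ _).
by rewrite polycyclic_mulE; apply/polycyclic_piP; exact: peqv_mul0.
Qed.

Lemma polycyclic_mul0 (x : polycyclic) : x * polycyclic_zero = polycyclic_zero.
Proof.
elim/polycyclic_ind: x => s; rewrite -[_ * _]/(polycyclic_mul _ _).
by rewrite polycyclic_mulE; apply/polycyclic_piP; exact: peqv_0mul.
Qed.

HB.instance Definition _ := InverseMonoid_hasZero.Build polycyclic
  polycyclic_0mul polycyclic_mul0.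

Lemma pgenV x y : pgen x * (pgen y)^-1 = if x == y then 1 else zerog.
Proof.
rewrite -[_^-1]/(polycyclic_inv _) -[_ * _]/(polycyclic_mul _ _).
rewrite polycyclic_invE polycyclic_mulE.
case: eqP => [->|xy]; apply/polycyclic_piP; first exact: peqv_gen_id.
exact: peqv_gen_zero.
Qed.

(* By [theta_hom], [theta_pgen] and [theta_inj], [theta] below is the injective
   homomorphism sending each generator [x] to [R_{p,x}]. *)
Fixpoint theta_term (s : pterm p) : partinj :=
  match s with
  | PGen x => Rab (ltn_ord x)
  | POne => 1
  | PZero => zerog
  | PMul s t => theta_term s * theta_term t
  | PInv s => (theta_term s)^-1
  end.

Lemma theta_term_peqv s t : peqv s t -> theta_term s = theta_term t.
Proof.
elim=> {s t} //=.
- by move=> s t u _ -> _ ->.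
- by move=> s s' t t' _ -> _ ->.
- by move=> s s' _ ->.
- by move=> s t u; rewrite mulgA.
- by move=> s; rewrite mul1g.
- by move=> s; rewrite mulg1.
- by move=> s; rewrite mul0g.
- by move=> s; rewrite mulg0.
- by move=> s; rewrite invgK.
- by move=> s t; rewrite invgM.
- by move=> s; rewrite mulgVg.
- by move=> s t; rewrite mulgVC.
- by move=> x; rewrite Rab_inv_mul eqxx.
- by move=> x y xy; rewrite Rab_inv_mul; case: eqP => // /val_inj.
Qed.

Definition theta (x : polycyclic) : partinj := theta_term (repr x).

Lemma theta_pi s : theta (pi s) = theta_term s.
Proof. exact/theta_term_peqv/polycyclic_repr. Qed.

Lemma theta_pgen x : theta (pgen x) = Rab (ltn_ord x).
Proof. exact: theta_pi. Qed.

Lemma theta_hom : inverse_monoid0_hom theta.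
Proof.
split; [split|..]; try exact: theta_pi.
- elim/polycyclic_ind=> s; elim/polycyclic_ind=> t.
  by rewrite -[_ * _]/(polycyclic_mul _ _) polycyclic_mulE !theta_pi.
- elim/polycyclic_ind=> s; rewrite -[_^-1]/(polycyclic_inv _).
  by rewrite polycyclic_invE !theta_pi.
Qed.

Lemma polycyclic_mulgE (x y : polycyclic) : polycyclic_mul x y = x * y.
Proof. by []. Qed.

Lemma polycyclic_invgE (x : polycyclic) : polycyclic_inv x = x^-1.
Proof. by []. Qed.

(* Words are stored in reverse, so that their last letter is the head. *)
Fixpoint pword (u : seq 'I_p) : polycyclic :=
  if u is x :: u' then pword u' * pgen x else 1.

Lemma pwordV u v : [\/ pword u * (pword v)^-1 = zerog,
  exists w, pword u * (pword v)^-1 = pword w |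
  exists w, pword u * (pword v)^-1 = (pword w)^-1].
Proof.
elim: u v => [|x u IH] [|y v] /=.
- by constructor 2; exists [::]; rewrite invg1 mulg1.
- by constructor 3; exists (y :: v); rewrite mul1g.
- by constructor 2; exists (x :: u); rewrite invg1 mulg1.
- rewrite invgM mulgA -[_ * pgen x * _]mulgA pgenV; case: eqP => _.
    by rewrite mulg1; exact: IH.
  by constructor 1; rewrite mulg0 mul0g.
Qed.

Lemma pword_cat u v : pword (u ++ v) = pword v * pword u.
Proof. by elim: u => [|x u IH] /=; rewrite ?mulg1 // IH mulgA. Qed.

Lemma invg0 : (zerog : polycyclic)^-1 = zerog.
Proof. by rewrite -{1}(mulg0 (zerog^-1)) invgM invgK mulg0. Qed.

Lemma polycyclic_normal (x : polycyclic) :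
  x = zerog \/ exists u v, x = (pword u)^-1 * pword v.
Proof.
elim/polycyclic_ind: x; elim=> [x|||s IHs t IHt|s IHs].
- by right; exists [::], [:: x]; rewrite /= invg1 !mul1g.
- by right; exists [::], [::]; rewrite /= invg1 mul1g.
- by left.
- rewrite -polycyclic_mulE polycyclic_mulgE.
  case: IHs => [->|[u [v ->]]]; first by left; rewrite mul0g.
  case: IHt => [->|[u' [v' ->]]]; first by left; rewrite mulg0.
  rewrite mulgA -[_ * pword v * _]mulgA.
  case: (pwordV v u') => [->|[w ->]|[w ->]].
  + by left; rewrite mulg0 mul0g.
  + by right; exists u, (v' ++ w); rewrite pword_cat mulgA.
  + by right; exists (u ++ w), v'; rewrite pword_cat invgM.
- rewrite -polycyclic_invE polycyclic_invgE.
  case: IHs => [->|[u [v ->]]]; first by left; rewrite invg0.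
  by right; exists v, u; rewrite invgM invgK.
Qed.

Fixpoint pword_val (u : seq 'I_p) : nat :=
  (if u is x :: u' then p * pword_val u' + x else 0)%N.

Lemma pword_val_inj u v : size u = size v -> pword_val u = pword_val v -> u = v.
Proof.
elim: u v => [|x u IH] [|y v] //= [suv] E.
have xy : x = y.
  apply/val_inj; move/(congr1 (modn^~ p)): E.
  by rewrite ![(p * _)%N]mulnC !modnMDl !modn_small.
subst y; congr (_ :: _); apply: IH => //; move/addIn/eqP: E.
by rewrite eqn_pmul2l ?(leq_trans _ (ltn_ord x)) // => /eqP.
Qed.

Lemma theta_pword u n m :
  theta (pword u) n = Some m <-> n = (p ^ size u * m + pword_val u)%N.
Proof.
have [[th1 thM] _ _] := theta_hom.
elim: u n => [|x u IH] n /=.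
  by rewrite th1 expn0 mul1n addn0; split=> [[]|->].
rewrite thM theta_pgen expnS -mulnA.
split=> [/partinj_compP[k /(Rab_funP _ _ (ltn_ord x)) -> /IH ->]|->].
  by rewrite mulnDr addnA.
apply/partinj_compP; exists (p ^ size u * m + pword_val u)%N; last exact/IH.
by apply/Rab_funP => //; rewrite mulnDr addnA.
Qed.

Lemma theta_normal u v n m :
  theta ((pword u)^-1 * pword v) n = Some m <->
  exists k, n = (p ^ size v * k + pword_val v)%N /\
            m = (p ^ size u * k + pword_val u)%N.
Proof.
have [[_ thM] thV _] := theta_hom; rewrite thM thV.
split=> [/partinj_compP[k /theta_pword -> /partinj_invP/theta_pword ->]|].
  by exists k.
move=> [k [-> ->]]; apply/partinj_compP.
by exists k; [exact/theta_pword|apply/partinj_invP/theta_pword].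
Qed.

Lemma theta_inj : 1 < p -> injective theta.
Proof.
move=> p1; have [_ _ th0] := theta_hom.
have nz u v : theta ((pword u)^-1 * pword v) <> zerog.
  move=> E; have : theta ((pword u)^-1 * pword v) (pword_val v) = Some (pword_val u).
    by apply/theta_normal; exists 0%N; rewrite !muln0.
  by rewrite E.
have aux u v u' v' :
    theta ((pword u)^-1 * pword v) = theta ((pword u')^-1 * pword v') ->
    [/\ pword_val u' <= pword_val u, pword_val v' <= pword_val v,
    pword_val u = pword_val u' -> p ^ size u' %| p ^ size u &
    pword_val v = pword_val v' -> p ^ size v' %| p ^ size v].
  move=> E; have H k : theta ((pword u')^-1 * pword v')
      (p ^ size v * k + pword_val v)%N = Some (p ^ size u * k + pword_val u)%N.
    by rewrite -E; apply/theta_normal; exists k.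
  have /theta_normal[k0] := H 0%N; have /theta_normal[k1] := H 1%N.
  rewrite !muln1 !muln0 !add0n => -[E1 E2] [E3 E4]; split.
  - by rewrite E4 leq_addl.
  - by rewrite E3 leq_addl.
  - by move=> e; move: E2; rewrite e => /addIn ->; exact: dvdn_mulr.
  - by move=> e; move: E1; rewrite e => /addIn ->; exact: dvdn_mulr.
move=> x y; case: (polycyclic_normal x) (polycyclic_normal y) => [->|[u [v ->]]].
  by case=> [->//|[u [v ->]]]; rewrite th0 => /esym/nz.
case=> [->|[u' [v' ->]]]; first by rewrite th0 => /nz.
move=> E; have [a1 a2 a3 a4] := aux _ _ _ _ E.
have [b1 b2 b3 b4] := aux _ _ _ _ (esym E).
have eu : pword_val u = pword_val u' by apply/eqP; rewrite eqn_leq a1 b1.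
have ev : pword_val v = pword_val v' by apply/eqP; rewrite eqn_leq a2 b2.
have su : size u = size u'.
  by apply/eqP; rewrite -(eqn_exp2l _ _ p1) eqn_dvd a3 // b3.
have sv : size v = size v'.
  by apply/eqP; rewrite -(eqn_exp2l _ _ p1) eqn_dvd a4 // b4.
by rewrite (pword_val_inj su eu) (pword_val_inj sv ev).
Qed.

End Polycyclic.

(* [logn p n] is ord_p(n) when [p] is prime and [n] is positive. *)
Definition padic_norm (p n : nat) : rat :=
  if n == 0 then 0%R else (p%:R ^- logn p n)%R.

Definition is_minimum (A : set rat) (x : rat) : Prop := A x /\ lbound A x.

(* Main.v *)
Require Import Defs.
From mathcomp Require Import all_boot all_order all_algebra.
From mathcomp Require Import boolp classical_sets.

Import Order.TTheory GRing.Theory Num.Theory.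

(** The word $0^k$ acts as exact division by $p^k$ ([theta_pgenX]), so it is defined at $n$ iff $p^k
    \mid n$. For $n > 0$ this means $k \le ord_p(n)$, and $n/p^k$ is least at the largest such $k$,
    where it equals $n \cdot \|n\|_p$. For $n = 0$ every value is $0$. *)

Lemma theta_pgenX p (x : 'I_p) (k n m : nat) : x = 0 :> nat ->
  theta (pgen x ^+ k)%g n = Some m <-> n = p ^ k * m.
Proof.
move=> x0; have [[th1 thM] _ _] := theta_hom p.
elim: k n m => [|k IH] n m.
  by rewrite expg0 th1 expn0 mul1n; split=> [[]|->].
rewrite expgS thM theta_pgen; split=> [/partinj_compP[j /IH -> /(Rab_funP _ _ (ltn_ord x)) ->]|->].
  by rewrite x0 addn0 expnSr mulnA.
(* Products apply right to left: the first $k$ divisions leave [p * m], and the last one removes the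
   remaining factor [p]. *)
apply/partinj_compP; exists (p * m); first by apply/IH; rewrite expnSr mulnA.
by apply/Rab_funP => //; rewrite x0 addn0.
Qed.

Theorem proposition46 (p : nat) (p_prime : prime p) (n : nat) :
  is_minimum
    [set x : rat | exists k m : nat,
       theta (pgen (Ordinal (prime_gt0 p_prime)) ^+ k)%g n = Some m
       /\ x = (m%:R)%R]
    (n%:R * padic_norm p n)%R.
Proof.
have pX_gt0 l : (0 < p%:R ^+ l :> rat)%R by rewrite exprn_gt0 // ltr0n prime_gt0.
rewrite /padic_norm; case: posnP => [->|n_gt0].
  rewrite mulr0; split; first by exists 0, 0; split=> //; apply/theta_pgenX.
  by move=> _ [k [m [_ ->]]]; exact: ler0n.
split.
  (* The minimum is attained by dividing out the full power of [p] in [n]. *)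
  exists (logn p n), (n %/ p ^ logn p n).
  have n_eq : n = p ^ logn p n * (n %/ p ^ logn p n).
    by rewrite mulnC divnK // pfactor_dvdnn.
  split; first exact/theta_pgenX.
  by rewrite {1}n_eq natrM natrX mulrC mulKf // gt_eqF.
move=> _ [k [m [/theta_pgenX-/(_ erefl) n_eq ->]]].
have k_le : k <= logn p n by rewrite -pfactor_dvdn // n_eq dvdn_mulr.
(* With denominators cleared and [n] written as [p ^ k * m], the bound reduces to
   [p ^ k <= p ^ logn p n]. *)
rewrite ler_pdivrMr // -natrX -natrM ler_nat {1}n_eq mulnC leq_mul2l.
by rewrite leq_pexp2l ?prime_gt0 ?orbT.
Qed.
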